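(* In every infinite-dimensional Hilbert space (real or complex, separable or not) there exists a universal dictionary.
   Context: Let $H$ be a Hilbert space with norm $|\cdot|$. A dictionary in $H$ is a subset $D$ of the unit sphere of $H$ with $\overline{\mathrm{span}}\,D=H$. For $m\in\mathbb{N}=\{1,2,\dots\}$, $\Sigma_m(D)=\{\sum_{k=1}^m\lambda_kg_k:\ \lambda_k\text{ scalars},\ g_k\in D\}$, $\sigma_m(x)=\mathrm{dist}(x,\Sigma_m(D))$ for $x\in H$, and $\sigma_0(x)=|x|$. A dictionary $D$ in $H$ is called universal if for every strictly decreasing real sequence $\alpha_0>\alpha_1>\dots$ with $\alpha_m\to0$ there exists $x\in H$ with $\sigma_m(x)=\alpha_m$ for all $m=0,1,2,\dots$ *)

(* Defs.v *)
From mathcomp Require Import all_boot all_order all_algebra.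
From mathcomp Require Import all_classical all_reals all_analysis.
From mathcomp Require Import complex.

Set Implicit Arguments.
Unset Strict Implicit.
Unset Printing Implicit Defensive.

Import Order.TTheory GRing.Theory Num.Theory.
Import numFieldNormedType.Exports.

Local Open Scope classical_set_scope.
Local Open Scope ring_scope.

(* The scalar field K is either a realType R or its complexification R[i].
   In the library the norm of a normedModType K takes its values in K; norms
   are read in R through re : K -> R, which is idfun if K is R and the real
   part if K is R[i], where `|x| has zero imaginary part. *)
Definition rnorm (R : realType) (K : numFieldType) (re : K -> R)
    (H : normedModType K) (x : H) : R := re `|x|.

Definition infinite_dimensional (K : numFieldType) (H : lmodType K) : Prop :=
  ~ exists (n : nat) (e : 'I_n -> H),
      forall x : H, exists c : 'I_n -> K, x = \sum_(k < n) c k *: e k.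

(* The g k need not be distinct; Sigma 0 D is [set 0]. *)
Definition Sigma (K : numFieldType) (H : lmodType K) (m : nat) (D : set H)
    : set H :=
  [set y | exists (c : 'I_m -> K) (g : 'I_m -> H),
     (forall k, D (g k)) /\ y = \sum_(k < m) c k *: g k].

Definition lspan (K : numFieldType) (H : lmodType K) (D : set H) : set H :=
  [set y | exists n : nat, Sigma n D y].

Definition dist (R : realType) (K : numFieldType) (re : K -> R)
    (H : normedModType K) (x : H) (S : set H) : R :=
  inf [set rnorm re (x - y) | y in S].

Definition sigma (R : realType) (K : numFieldType) (re : K -> R)
    (H : normedModType K) (D : set H) (m : nat) (x : H) : R :=
  if m is 0%N then rnorm re x else dist re x (Sigma m D).

Definition dictionary (K : numFieldType) (H : normedModType K) (D : set H)
    : Prop :=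
  D `<=` [set g | `|g| = 1] /\ closure (lspan D) = setT.

Definition universal_dictionary (R : realType) (K : numFieldType) (re : K -> R)
    (H : normedModType K) (D : set H) : Prop :=
  dictionary D /\
  forall alpha : R^nat,
    (forall m : nat, alpha m.+1 < alpha m) ->
    alpha @ \oo --> 0 ->
    exists x : H, forall m : nat, sigma re D m x = alpha m.

(* A Hilbert space over K is a completeNormedModType K whose norm comes from an
   inner product; theta is the conjugation of K, and {dot H for theta} is the
   type of positive definite forms that are linear in the first argument and
   satisfy ip x y = theta (ip y x). *)
Definition norm_of_dot (K : numFieldType) (theta : K -> K)
    (H : normedModType K) (ip : {dot H for theta}) : Prop :=
  forall x : H, `|x| ^+ 2 = ip x x.

(* Main.v *)
Require Import Defs.
From HB Require Import structures.
From mathcomp Require Import all_boot all_order all_algebra.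
From mathcomp Require Import all_classical all_reals all_analysis.
From mathcomp Require Import complex ring lra.

Set Implicit Arguments.
Unset Strict Implicit.
Unset Printing Implicit Defensive.

Import Order.TTheory GRing.Theory Num.Theory.
Import numFieldNormedType.Exports.
Local Open Scope classical_set_scope.
Local Open Scope ring_scope.
Local Open Scope complex_scope.

(** Put x_i = sqrt (alpha_i ^ 2 - alpha_(i+1) ^ 2) > 0. For an orthonormal
    sequence e_0, e_1, ... the vector x = sum_i x_i e_i lies at distance exactly
    alpha_m from span (e_0, ..., e_(m-1)). The dictionary has to let m of its
    elements come arbitrarily close to that span, while no other choice of m
    elements does better, for all sequences alpha at once.

    Curves of moments. Let u_0, u_1, ... be orthogonal vectors, let w_0 > w_1 > ...
    be rapidly decreasing weights, and consider the vectors
    g(l) = sum_i l ^ i w_i u_i with |l| <= 1. A combination of r of them has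
    coefficients a_i = w_i p_i, where p_i is the i-th moment of r nodes in the
    unit disc. Moments satisfy |p_i| <= 3 ^ i max_(j<r) |p_j|
    ([moment_growth]), so for i >= r the coefficient a_i is negligible compared
    with the first r coefficients ([coef_decay]): r elements of the curve reach
    essentially nothing but u_0, ..., u_(r-1), and by the Vandermonde
    determinant they do reach these ([moment_interpolation]).

    Tilting. The gain of a combination in the directions u_i with i >= r, though
    tiny, is of first order and has to be compensated exactly. For this u_i is
    not e_i but e_i + t f_i, where f_i is a new basis vector orthogonal to x.
    Each use of the curve then costs t ^ 2 sum_i |a_i| ^ 2. As the
    weights are small compared with t ^ 2, this cost exceeds the gain, unless
    the coefficients are so small that some e_i with i < m is badly approximated
    anyway ([loss_le_penalty]). Letting t tend to 0 along a family of curves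
    brings m elements as close to span (e_0, ..., e_(m-1)) as desired
    ([near_best_combination]).

    Universality. How fast the weights must decrease depends on alpha, so the
    basis vectors e are indexed by the nodes of the tree of finite sequences of
    natural numbers. There is one curve for each node v; it runs through the
    basis vectors of the prefixes of v, and the entries of v say how
    fast its weights decrease. For a given alpha the vector x is carried by the
    branch of the tree whose entries grow fast enough for alpha
    ([choose_branch]). A curve whose node leaves this branch meets x only in the
    common prefixes, and there its weights decrease as fast as those of the
    branch; so the comparison applies to all curves at once
    ([dist_combination_ge]).

    Finally, all unit vectors orthogonal to this countable orthonormal family
    are added to the dictionary: they make its span dense in a space of any
    density character, and being orthogonal to x and to all the curves, they do
    not help to approximate x. *)

(** * Moments *)

Definition moment (K : pzRingType) (L : seq (K * K)) (i : nat) : K :=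
  \sum_(q <- L) q.1 * q.2 ^+ i.

(** Removing a node l0 from a family with moments p_i leaves a family, with other
    coefficients, whose moments are p_(i+1) - l0 p_i. By induction on the number
    of nodes these are at most 3 ^ i (2 B), and then
    |p_(i+1)| <= 3 ^ i (2 B) + 3 ^ i B. *)
Lemma moment_growth (K : numDomainType) (L : seq (K * K)) (B : K) :
  0 <= B -> (forall q, q \in L -> `|q.2| <= 1) ->
  (forall j, (j < size L)%N -> `|moment L j| <= B) ->
  forall i, `|moment L i| <= 3 ^+ i * B.
Proof.
move szL: (size L) => n.
elim: n L szL B => [|n IH] [|q0 L] //= szL B B0 L1 LB i.
  by rewrite /moment big_nil normr0 mulr_ge0 ?exprn_ge0.
pose L' := [seq (q.1 * (q.2 - q0.2), q.2) | q <- L].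
have step j : moment (q0 :: L) j.+1
    = moment L' j + q0.2 * moment (q0 :: L) j.
  rewrite /moment /L' big_map !big_cons /= mulrDr addrCA; congr (_ + _).
    by rewrite exprS; ring.
  rewrite mulr_sumr -big_split /=; apply: eq_bigr => q _.
  by rewrite exprS; ring.
have q1 : `|q0.2| <= 1 by apply: L1; rewrite mem_head.
have shrink j : `|q0.2 * moment (q0 :: L) j| <= `|moment (q0 :: L) j|.
  by rewrite normrM ler_piMl.
have L'B j : `|moment L' j| <= 3 ^+ j * (2 * B).
  case: szL => szL; apply: IH; [by rewrite size_map|by rewrite mulr_ge0| |].
    by move=> _ /mapP[q qL ->] /=; apply: L1; rewrite inE qL orbT.
  move=> k kL.
  have -> : moment L' k = moment (q0 :: L) k.+1 - q0.2 * moment (q0 :: L) k.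
    by rewrite step addrK.
  apply: le_trans (ler_normB _ _) _; rewrite mulr2n mulrDl mul1r lerD ?LB //.
  by apply: le_trans (shrink k) _; apply: LB; rewrite ltnS ltnW.
elim: i => [|i IHi]; first by rewrite expr0 mul1r; apply: LB.
rewrite step; apply: le_trans (ler_normD _ _) _.
have -> : 3 ^+ i.+1 * B = 3 ^+ i * (2 * B) + 3 ^+ i * B by rewrite exprS; ring.
by rewrite lerD //; apply: le_trans (shrink i) _.
Qed.

Lemma moment_interpolation (K : numFieldType) (m : nat) (p : nat -> K) :
  exists b : 'I_m -> K,
    forall i, (i < m)%N -> \sum_(k < m) b k * (k.+1%:R^-1) ^+ i = p i.
Proof.
pose a : 'rV[K]_m := \row_k (k.+1%:R^-1).
have unitA : Vandermonde m a \in unitmx.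
  rewrite unitmxE det_Vandermonde unitfE.
  apply/prodf_neq0 => i _; apply/prodf_neq0 => j ij; rewrite !mxE subr_eq0.
  by rewrite (inj_eq invr_inj) eqr_nat eqSS neq_ltn ij orbT.
pose c : 'cV[K]_m := invmx (Vandermonde m a) *m \col_i p i.
exists (fun k => c k 0) => i im.
have := congr1 (fun M : 'cV[K]_m => M (Ordinal im) 0) (mulKVmx unitA (\col_i p i)).
rewrite -/c !mxE => <-; apply: eq_bigr => k _.
by rewrite !mxE mulrC.
Qed.

(** * Comparison of gain and cost *)

Lemma sum_seq_sqr_le (R : realFieldType) (T : eqType) (V : seq T) (f : T -> R) :
  (\sum_(v <- V) f v) ^+ 2 <= (size V)%:R * \sum_(v <- V) f v ^+ 2.
Proof.
elim: V => [|v V IH]; first by rewrite !big_nil expr2 !mul0r.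
rewrite !big_cons /= -natr1.
set S := \sum_(j <- V) f j in IH *; set Q := \sum_(j <- V) _ in IH *.
set n := (size V)%:R in IH *; have n0 : 0 <= n by rewrite ler0n.
have Q0 : 0 <= Q by apply: sumr_ge0 => ? _; rewrite sqr_ge0.
have : 2 * f v * S <= n * f v ^+ 2 + Q.
  have [n_eq|n_neq] := eqVneq n 0.
    have V0 : V = [::].
      by apply/size0nil/eqP; rewrite -(eqr_nat R) -/n n_eq.
    by rewrite n_eq /S V0 big_nil mulr0 mul0r add0r.
  have npos : 0 < n by rewrite lt_neqAle eq_sym n_neq.
  rewrite -(ler_pM2l npos).
  have := sqr_ge0 (n * f v - S); nra.
nra.
Qed.

(** The curves used, at most m of them, are listed in V; r v is the number of
    elements taken from the curve v, tilt v its tilt, M v the Euclidean norm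
    of its coefficients, A v i the modulus of the i-th one. The vector to
    approximate has coordinates x i, and t i is the error left on the i-th one.

    With W = sum_v tilt v ^ 2 * M v, the gain on the coordinates from m on is at
    most kappa * W. If a single curve is used, then either M v >= kappa and the
    cost is at least the gain, or the coordinate 0 is missed. Otherwise
    every curve contributes fewer than m elements: if W >= m kappa, the cost is
    at least the gain by the Cauchy-Schwarz inequality, and if W < m kappa,
    the coordinate m - 1, which no curve reaches well, is missed. *)
Lemma loss_le_penalty (R : realFieldType) (T : eqType) (V : seq T) (tilt M : T -> R)
  (A : T -> nat -> R) (r : T -> nat) (x tau t : nat -> R) (m I : nat) (kappa : R) :
  (0 < m <= I)%N -> (size V <= m)%N ->
  (forall v, v \in V -> [/\ 0 < tilt v <= 1, 0 <= M v & (r v <= m)%N]) ->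
  (forall v i, v \in V -> 0 <= A v i <= M v) ->
  (forall v i, v \in V -> (r v <= i)%N -> A v i <= tau i * (tilt v ^+ 2 * M v)) ->
  (forall i, 0 <= x i) ->
  (forall i, 0 <= t i) ->
  (forall i, x i - \sum_(v <- V) A v i <= t i) ->
  (exists v, V = [:: v]) \/ (forall v, v \in V -> (r v < m)%N) ->
  \sum_(m <= i < I) 2 * x i * tau i <= kappa ->
  m%:R * kappa <= x 0%N / 2 -> m%:R * kappa <= x m.-1 / 2 ->
  0 <= kappa -> tau m.-1 <= 1 ->
  \sum_(m <= i < I) x i ^+ 2
  <= \sum_(i < I) t i ^+ 2 + \sum_(v <- V) (tilt v * M v) ^+ 2.
Proof.
move=> /andP[m0 mI] szV HV HA HAr x0 t0 tx Hcase Hk Hk0 Hkm k0 tau1.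
pose W := \sum_(v <- V) tilt v ^+ 2 * M v.
have W0 : 0 <= W.
  rewrite /W big_seq; apply: sumr_ge0 => v vV; have [_ Mv _] := HV v vV.
  by rewrite mulr_ge0 ?sqr_ge0.
pose S i := \sum_(v <- V) A v i.
have S0 i : 0 <= S i.
  by rewrite /S big_seq; apply: sumr_ge0 => v vV; have /andP[] := HA v i vV.
have SW i : (forall v, v \in V -> (r v <= i)%N) -> S i <= tau i * W.
  move=> ri; rewrite /S /W mulr_sumr big_seq [leRHS]big_seq.
  by apply: ler_sum => v vV; apply: HAr => //; apply: ri.
have rV v : v \in V -> (r v <= m)%N by move=> /HV[].
have tail : \sum_(m <= i < I) x i ^+ 2 - kappa * W <= \sum_(m <= i < I) t i ^+ 2.
  rewrite lerBlDr; apply: (@le_trans _ _ (\sum_(m <= i < I) t i ^+ 2 +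
     (\sum_(m <= i < I) 2 * x i * tau i) * W)); last first.
    by rewrite lerD2l; apply: ler_wpM2r.
  rewrite mulr_suml -big_split /=; rewrite big_nat [leRHS]big_nat.
  apply: ler_sum => i /andP[mi _].
  have := SW i (fun v vV => leq_trans (rV v vV) mi).
  rewrite -[2 * x i * tau i * W]mulrA.
  move: (S0 i) (x0 i) (t0 i) (tx i); rewrite -/(S i).
  move: (S i) (x i) (t i) (tau i * W) => s y u w s0 y0 u0 yu sw.
  have : 2 * y * s <= 2 * y * w by rewrite ler_wpM2l // mulr_ge0.
  have [ys|/ltW sy] := leP y s; first by nra.
  have : (y - s) ^+ 2 <= u ^+ 2 by rewrite ler_pXn2r // nnegrE subr_ge0.
  nra.
have split : \sum_(i < I) t i ^+ 2
    = \sum_(0 <= i < m) t i ^+ 2 + \sum_(m <= i < I) t i ^+ 2.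
  by rewrite -(big_mkord xpredT (fun i => t i ^+ 2)) (big_cat_nat _ mI).
rewrite split.
have head j : (j < m)%N -> t j ^+ 2 <= \sum_(0 <= i < m) t i ^+ 2.
  move=> jm; rewrite (bigD1_seq j) ?mem_index_iota ?iota_uniq //= lerDl.
  by apply: sumr_ge0 => ? _; rewrite sqr_ge0.
suff : kappa * W <= \sum_(0 <= i < m) t i ^+ 2 + \sum_(v <- V) (tilt v * M v) ^+ 2.
  by move: tail; lra.
have P0 : 0 <= \sum_(v <- V) (tilt v * M v) ^+ 2.
  by apply: sumr_ge0 => ? _; rewrite sqr_ge0.
have H0 : 0 <= \sum_(0 <= i < m) t i ^+ 2.
  by apply: sumr_ge0 => ? _; rewrite sqr_ge0.
have m1 : 1 <= m%:R :> R by rewrite ler1n.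
have kmk : kappa <= m%:R * kappa by rewrite ler_peMl.
case: Hcase => [[v Vv]|rm].
  have vV : v \in V by rewrite Vv mem_head.
  have [/andP[th0 th1] Mv0 _] := HV v vV.
  have /andP[Av0 AvM] := HA v 0%N vV.
  move: (tx 0%N) (head 0%N m0) H0; rewrite /W Vv !big_seq1.
  set h := \sum_(0 <= i < m) _ => tx0 hh H0.
  have th2 : 0 <= tilt v ^+ 2 <= 1 by rewrite sqr_ge0 expr_le1 // ltW.
  have [kM|Mk] := leP kappa (M v).
    have : tilt v ^+ 2 * M v * kappa <= tilt v ^+ 2 * M v * M v.
      by rewrite ler_wpM2l // mulr_ge0 // sqr_ge0.
    rewrite exprMn; nra.
  have tk : kappa <= t 0%N by lra.
  have : kappa * kappa <= t 0%N ^+ 2 by rewrite expr2 ler_pM.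
  have : tilt v ^+ 2 * M v <= kappa.
    by apply: le_trans (ltW Mk); rewrite ler_piMl //; case/andP: th2.
  have : 0 <= (tilt v * M v) ^+ 2 by rewrite sqr_ge0.
  nra.
have [Wk|Wk] := leP (m%:R * kappa) W.
  have : W ^+ 2 <= m%:R * \sum_(v <- V) (tilt v * M v) ^+ 2.
    apply: le_trans (sum_seq_sqr_le _ _) _; apply: ler_pM.
    - by [].
    - by apply: sumr_ge0 => ? _; rewrite sqr_ge0.
    - by rewrite ler_nat.
    rewrite big_seq [leRHS]big_seq; apply: ler_sum => v vV.
    have [/andP[th0 th1] Mv0 _] := HV v vV.
    rewrite !exprMn ler_wpM2r ?sqr_ge0 // ler_piMl ?sqr_ge0 //.
    by rewrite expr_le1 // ltW.
  have mp : 0 < m%:R :> R by lra.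
  move=> WW; have : m%:R * (kappa * W) <= m%:R * \sum_(v <- V) (tilt v * M v) ^+ 2.
    by apply: le_trans WW; rewrite mulrA expr2 ler_wpM2r.
  by rewrite (ler_pM2l mp); lra.
have Sm : S m.-1 <= m%:R * kappa.
  apply: le_trans (SW _ _) _; first by move=> v /rm vm; rewrite -ltnS prednK.
  by apply: le_trans (ltW Wk); rewrite ler_piMl.
have tm : m%:R * kappa <= t m.-1 by move: (tx m.-1); rewrite -/(S _); lra.
have := head m.-1; rewrite ltn_predL => /(_ m0) hh.
have : kappa * W <= (m%:R * kappa) ^+ 2.
  by rewrite expr2 ler_pM // ltW.
have : (m%:R * kappa) ^+ 2 <= t m.-1 ^+ 2.
  by rewrite ler_pXn2r // nnegrE; lra.
lra.
Qed.

(** * Hilbert spaces over R or R[i] *)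

(** The scalar field K is R or R[i], with real part re, inclusion io of R and
    conjugation theta. Moduli and norms are compared in R, where the order is
    total. *)
Section HilbertSpace.
Variables (R : realType) (K : numFieldType) (re : K -> R).
Variables (io : {rmorphism R -> K}) (theta : K -> K).
Hypothesis io_le : {mono io : r s / r <= s}.
Hypothesis ioK : cancel io re.
Hypothesis normE : forall a : K, `|a| = io (re `|a|).
Hypothesis theta0 : theta 0 = 0.
Variables (H : completeNormedModType K) (ip : H -> H -> K).
Hypothesis ip_linear : forall a x y z, ip (a *: x + y) z = a * ip x z + ip y z.
Hypothesis ipC : forall x y, ip x y = theta (ip y x).
Hypothesis ip_norm : forall x, `|x| ^+ 2 = ip x x.

Local Notation nrm := (rnorm re).
Definition absR (a : K) : R := re `|a|.

Lemma io_lt : {mono io : r s / r < s}.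
Proof. by move=> r s; rewrite !lt_neqAle io_le (inj_eq (can_inj ioK)). Qed.

Lemma normrE (x : H) : `|x| = io (nrm x).
Proof. by rewrite -[LHS]normr_id normE normr_id. Qed.

Lemma absRE (a : K) : `|a| = io (absR a). Proof. exact: normE. Qed.

Lemma absR_ge0 a : 0 <= absR a.
Proof. by rewrite -io_le rmorph0 -absRE. Qed.

Lemma absRM a b : absR (a * b) = absR a * absR b.
Proof. by apply: (can_inj ioK); rewrite rmorphM -!absRE normrM. Qed.

Lemma absRD a b : absR (a + b) <= absR a + absR b.
Proof. by rewrite -io_le rmorphD -!absRE ler_normD. Qed.

Lemma absRN a : absR (- a) = absR a. Proof. by rewrite /absR normrN. Qed.

Lemma absR0 : absR 0 = 0. Proof. by rewrite /absR normr0 -(rmorph0 io) ioK. Qed.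

Lemma absR_io r : 0 <= r -> absR (io r) = r.
Proof. by move=> r0; rewrite /absR ger0_norm ?ioK // -(rmorph0 io) io_le. Qed.

Lemma absR_sum (T : Type) (s : seq T) (P : pred T) (f : T -> K) :
  absR (\sum_(i <- s | P i) f i) <= \sum_(i <- s | P i) absR (f i).
Proof.
elim/big_ind2 : _ => [|a r b s' ar bs|//]; first by rewrite absR0.
by apply: le_trans (absRD _ _) _; apply: lerD.
Qed.

Lemma absR_eq0 a : (absR a == 0) = (a == 0).
Proof. by rewrite -(inj_eq (can_inj ioK)) rmorph0 -absRE normr_eq0. Qed.

Lemma nrm_ge0 (x : H) : 0 <= nrm x.
Proof. by rewrite -io_le rmorph0 -normrE. Qed.

Lemma nrmZ (a : K) (x : H) : nrm (a *: x) = absR a * nrm x.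
Proof. by apply: (can_inj ioK); rewrite rmorphM -absRE -!normrE normrZ. Qed.

Lemma nrmD (x y : H) : nrm (x + y) <= nrm x + nrm y.
Proof. by rewrite -io_le rmorphD -!normrE ler_normD. Qed.

Lemma nrmN (x : H) : nrm (- x) = nrm x.
Proof. by rewrite /rnorm normrN. Qed.

Lemma nrmB (x y : H) : nrm (x - y) = nrm (y - x).
Proof. by rewrite /rnorm distrC. Qed.

Lemma nrm0 : nrm (0 : H) = 0.
Proof. by rewrite /rnorm normr0 -(rmorph0 io) ioK. Qed.

Lemma nrm_sum (T : Type) (s : seq T) (P : pred T) (f : T -> H) :
  nrm (\sum_(i <- s | P i) f i) <= \sum_(i <- s | P i) nrm (f i).
Proof.
elim/big_ind2 : _ => [|a r b s' ar bs|//]; first by rewrite nrm0.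
by apply: le_trans (nrmD _ _) _; apply: lerD.
Qed.

Lemma ip_sq (x : H) : ip x x = io (nrm x ^+ 2).
Proof. by rewrite -ip_norm normrE rmorphXn. Qed.

Lemma ip0l x : ip 0 x = 0.
Proof. by have := ip_linear (-1) x x x; rewrite scaleN1r addNr mulN1r addNr. Qed.

Lemma ipDl x y z : ip (x + y) z = ip x z + ip y z.
Proof. by have := ip_linear 1 x y z; rewrite scale1r mul1r. Qed.

Lemma ipZl a x z : ip (a *: x) z = a * ip x z.
Proof. by have := ip_linear a x 0 z; rewrite addr0 ip0l addr0. Qed.

Lemma ipBl x y z : ip (x - y) z = ip x z - ip y z.
Proof. by rewrite ipDl -scaleN1r ipZl mulN1r. Qed.

Lemma ip_suml (T : Type) (s : seq T) (P : pred T) (f : T -> H) z :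
  ip (\sum_(i <- s | P i) f i) z = \sum_(i <- s | P i) ip (f i) z.
Proof.
elim/big_rec2: _ => [|i y1 y2 _ IH]; first by rewrite ip0l.
by rewrite ipDl IH.
Qed.

Lemma ip_orthC x y : ip x y = 0 -> ip y x = 0.
Proof. by move=> xy; rewrite ipC xy theta0. Qed.

Lemma pythagoras (x y : H) : ip x y = 0 -> nrm (x + y) ^+ 2 = nrm x ^+ 2 + nrm y ^+ 2.
Proof.
move=> xy; apply: (can_inj ioK); rewrite rmorphD -!ip_sq ipDl.
congr (_ + _); rewrite ipC ipDl.
  by rewrite (ip_orthC xy) addr0 -ipC.
by rewrite xy add0r -ipC.
Qed.

Lemma nrm_unit (b : H) : ip b b = 1 -> nrm b = 1.
Proof.
rewrite ip_sq -(rmorph1 io) => /(can_inj ioK) /eqP.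
by rewrite sqrf_eq1 => /orP[/eqP //|/eqP b1]; have := nrm_ge0 b; rewrite b1; lra.
Qed.

(** By induction on the family: subtracting from z its component along one vector
    changes the inner products with none of the others. *)
Lemma bessel (T : eqType) (S : seq T) (b : T -> H) (z : H) :
  uniq S -> (forall s t, s \in S -> t \in S -> ip (b s) (b t) = (s == t)%:R) ->
  \sum_(t <- S) absR (ip z (b t)) ^+ 2 <= nrm z ^+ 2.
Proof.
elim: S z => [|s S IH] z /=; first by rewrite big_nil sqr_ge0.
move=> /andP[sS uS] on; rewrite big_cons.
have bs1 : ip (b s) (b s) = 1 by rewrite on ?mem_head // eqxx.
set c := ip z (b s); pose w := z - c *: b s.
have ws : ip w (c *: b s) = 0.
  by apply: ip_orthC; rewrite ipZl ip_orthC ?mulr0 // ipBl ipZl bs1 mulr1 subrr.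
have -> : z = w + c *: b s by rewrite subrK.
rewrite pythagoras // nrmZ (nrm_unit bs1) mulr1 addrC lerD2r.
have <- : \sum_(t <- S) absR (ip w (b t)) ^+ 2
        = \sum_(t <- S) absR (ip (w + c *: b s) (b t)) ^+ 2.
  rewrite big_seq [RHS]big_seq; apply: eq_bigr => t tS.
  rewrite ipDl ipZl on ?mem_head ?inE ?tS ?orbT //.
  case: eqP => [st|_]; first by rewrite st tS in sS.
  by rewrite mulr0 addr0.
by apply: IH => // t u tS uS'; apply: on; rewrite inE ?tS ?uS' orbT.
Qed.

Lemma cauchy_schwarz_unit (z b : H) : ip b b = 1 -> absR (ip z b) <= nrm z.
Proof.
move=> b1; have := @bessel unit [:: tt] (fun=> b) z isT.
rewrite big_seq1 ler_pXn2r ?nnegrE ?absR_ge0 ?nrm_ge0 //; apply => -[] [] _ _.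
by rewrite b1.
Qed.

Section OrthonormalSeries.
Variables (b : nat -> H) (c : nat -> K).
Hypothesis on : forall i j, ip (b i) (b j) = (i == j)%:R.

Local Notation psum n := (\sum_(i < n) c i *: b i).

Lemma ip_partial n j : (j < n)%N -> ip (psum n) (b j) = c j.
Proof.
move=> jn; rewrite ip_suml (bigD1 (Ordinal jn)) //= ipZl on eqxx mulr1 big1 ?addr0 //.
by move=> i; rewrite -val_eqE /= ipZl on => /negPf->; rewrite mulr0.
Qed.

Lemma nrm_partial m n : (m <= n)%N ->
  nrm (psum n - psum m) ^+ 2 = \sum_(m <= i < n) absR (c i) ^+ 2.
Proof.
have split : (m <= n)%N -> psum n - psum m = \sum_(m <= i < n) c i *: b i.
  move=> mn; rewrite -!(big_mkord xpredT (fun i => c i *: b i)).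
  by rewrite (big_cat_nat _ mn) //= addrAC subrr add0r.
move=> mn; rewrite split //; elim: n mn {split} => [|n IH].
  by rewrite leqn0 => /eqP->; rewrite !big_geq // nrm0 expr0n.
rewrite leq_eqVlt => /orP[/eqP->|]; first by rewrite !big_geq // nrm0 expr0n.
rewrite ltnS => mn; rewrite !big_nat_recr //= pythagoras ?IH //.
  by rewrite nrmZ nrm_unit ?mulr1 // on eqxx.
apply: ip_orthC; rewrite ipZl ip_orthC ?mulr0 // ip_suml big_nat big1 // => i /andP[_ ilt].
by rewrite ipZl on (ltn_eqF ilt) mulr0.
Qed.

(** The squared distance between two partial sums is a difference of two terms of
    a bounded nondecreasing real sequence, so the partial sums form a Cauchy
    sequence. *)
Lemma orthonormal_series (B : R) :
  (forall n, \sum_(i < n) absR (c i) ^+ 2 <= B) ->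
  exists x : H, forall e, 0 < e ->
    exists N, forall n, (N <= n)%N -> nrm (x - psum n) < e.
Proof.
move=> cB; pose s n := \sum_(i < n) absR (c i) ^+ 2.
have sup_s : has_sup (range s).
  by split; [exists (s 0%N), 0%N|exists B => _ [n _ <-]; apply: cB].
have tail e : 0 < e -> exists N, forall n, (N <= n)%N -> nrm (psum n - psum N) < e.
  move=> e0; have e20 : 0 < e ^+ 2 by rewrite exprn_gt0.
  have [_ [N _ <-] sN] := sup_adherent e20 sup_s; exists N => n Nn.
  rewrite -(@ltr_pXn2r _ 2) ?nnegrE ?nrm_ge0 ?ltW // nrm_partial //.
  have : s n <= sup (range s) by apply: sup_ubound; [case: sup_s|exists n].
  rewrite {1}/s -(big_mkord xpredT (fun i => absR (c i) ^+ 2)) (big_cat_nat _ Nn) //=.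
  by rewrite big_mkord -/(s N); lra.
have [x xS] : exists x : H, (fun n => psum n) @ \oo --> x.
  apply/cvg_ex; apply: cauchy_cvg; apply: cauchy_exP => eps eps0.
  have epsE : eps = io (re eps) by rewrite -(gtr0_norm eps0) -normE.
  have e0 : 0 < re eps by rewrite -io_lt -epsE rmorph0.
  have [N NS] := tail _ e0; exists (psum N); exists N => // n /= Nn.
  by rewrite -ball_normE /ball_ /= epsE normrE io_lt nrmB; apply: NS.
exists x => e e0; have ie0 : 0 < io e by rewrite -(rmorph0 io) io_lt.
move/cvgrPdist_lt: xS => /(_ _ ie0)[N _ NS]; exists N => n Nn.
by rewrite -io_lt -normrE; apply: NS.
Qed.

Variable x : H.
Hypothesis xS : forall e, 0 < e ->
    exists N, forall n, (N <= n)%N -> nrm (x - psum n) < e.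

Lemma small_eq0 (r : R) : 0 <= r -> (forall e, 0 < e -> r < e) -> r = 0.
Proof.
move=> r0 re0; apply/eqP; rewrite eq_le r0 andbT leNgt; apply/negP => /re0.
by rewrite ltxx.
Qed.

Lemma ip_series j : ip x (b j) = c j.
Proof.
apply/eqP; rewrite -subr_eq0 -absR_eq0; apply/eqP/small_eq0 => [|e e0].
  exact: absR_ge0.
have [N NS] := xS e0; have jn := leq_maxr N j.+1.
rewrite -(ip_partial jn) -ipBl; apply: le_lt_trans (NS _ (leq_maxl N j.+1)).
by apply: cauchy_schwarz_unit; rewrite on eqxx.
Qed.

Lemma ip_series_orth z : ip z z = 1 -> (forall j, ip (b j) z = 0) -> ip x z = 0.
Proof.
move=> z1 bz; apply/eqP; rewrite -absR_eq0; apply/eqP/small_eq0 => [|e e0].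
  exact: absR_ge0.
have [N NS] := xS e0.
have -> : ip x z = ip (x - psum N) z.
  by rewrite ipBl [ip (psum N) z]ip_suml big1 ?subr0 // => i _; rewrite ipZl bz mulr0.
by apply: le_lt_trans (cauchy_schwarz_unit _ z1) _; apply: NS.
Qed.

End OrthonormalSeries.


Lemma normalize (y : H) : y != 0 ->
  `|(`|y|^-1 *: y)| = 1 /\ ip (`|y|^-1 *: y) (`|y|^-1 *: y) = 1.
Proof.
move=> y0; have n1 : `|(`|y|^-1 *: y)| = 1.
  by rewrite normrZ normfV normr_id mulVf // normr_eq0.
by rewrite -ip_norm n1 expr1n.
Qed.

(** Gram-Schmidt, with a vector outside the span of the previous ones chosen at
    each step. *)
Lemma orthonormal_sequence : infinite_dimensional H ->
  exists b : nat -> H, forall i j, ip (b i) (b j) = (i == j)%:R.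
Proof.
move=> infH.
pose on (S : seq H) := forall i j, (i < size S)%N -> (j < size S)%N ->
  ip S`_i S`_j = (i == j)%:R.
have next (S : seq H) : exists u, on S ->
    ip u u = 1 /\ forall i, (i < size S)%N -> ip u S`_i = 0.
  have [onS|] := pselect (on S); last by exists 0.
  have [w wS] : exists w, forall c : 'I_(size S) -> K, w <> \sum_k c k *: S`_k.
    apply: contrapT => spanS; apply: infH; exists (size S), (fun k => S`_k) => w.
    by apply: contrapT => wS; apply: spanS; exists w => c wc; apply: wS; exists c.
  pose w' := w - \sum_(k < size S) ip w S`_k *: S`_k.
  have w'0 : w' != 0 by rewrite subr_eq0; apply/eqP; apply: wS.
  exists (`|w'|^-1 *: w') => _; split; first by case: (normalize w'0).
  move=> i iS; rewrite ipZl ipBl ip_suml (bigD1 (Ordinal iS)) //= ipZl onS // eqxx.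
  rewrite mulr1 big1 ?addr0 ?subrr ?mulr0 // => j.
  by rewrite -val_eqE /= ipZl onS // => /negPf->; rewrite mulr0.
have [nxt nxtP] := choice next.
pose B n := iter n (fun S => rcons S (nxt S)) [::].
have sizeB n : size (B n) = n by elim: n => //= n IH; rewrite size_rcons IH.
have nthB n i : (i < n)%N -> (B n)`_i = nxt (B i).
  elim: n => // n IH; rewrite ltnS leq_eqVlt => /orP[/eqP->|ilt] /=.
    by rewrite nth_rcons sizeB ltnn eqxx.
  by rewrite nth_rcons sizeB ilt IH.
have onB n : on (B n).
  elim: n => [|n IH] i j; first by rewrite /=.
  have [un uB] := nxtP _ IH; rewrite sizeB in uB.
  rewrite sizeB !ltnS leq_eqVlt => /orP[/eqP->|ilt]; rewrite leq_eqVlt => /orP[/eqP->|jlt].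
  - by rewrite nthB // eqxx.
  - by rewrite !nthB ?(leqW jlt) // -(nthB n j) // uB // gtn_eqF.
  - by rewrite !nthB ?(leqW ilt) // -(nthB n i) // ip_orthC ?uB // ltn_eqF.
  - by rewrite !nthB ?(leqW ilt) ?(leqW jlt) // -(nthB n i) // -(nthB n j) // IH // sizeB.
exists (fun n => nxt (B n)) => i j.
have im : (i < (maxn i j).+1)%N by rewrite ltnS leq_maxl.
have jm : (j < (maxn i j).+1)%N by rewrite ltnS leq_maxr.
by rewrite -(nthB _ _ im) -(nthB _ _ jm) onB ?sizeB.
Qed.

(** * The dictionary *)

Section Dictionary.
Variable b : nat -> H.
Hypothesis on : forall i j, ip (b i) (b j) = (i == j)%:R.

(** An orthonormal sequence is split into a family indexed by the nodes of the
    tree and, for each node v, the vectors pen v i that penalize the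
    use of the curve attached to v. *)
Definition node (v : seq nat) : H := b (pickle (v, 0%N)).
Definition pen (v : seq nat) (i : nat) : H := b (pickle (v, i.+1)).

Lemma pickle_pen v i : b (pickle (v, i.+1)) = pen v i.
Proof. by []. Qed.

Definition tilt (v : seq nat) : R := (size v).+1%:R^-1.
(** The factor 3 ^ (j+1) absorbs the growth of moments, and tilt v ^ 2 makes the
    gain smaller than the cost of the tilt. The entry of v at j makes the weights
    decrease as fast as desired from the j-th one to the next. *)
Definition ratio (v : seq nat) (j : nat) : R :=
  tilt v ^+ 2 / (3 ^+ j.+1 * (nth 0%N v j).+1%:R).
Definition weight (v : seq nat) (i : nat) : R := \prod_(j < i) ratio v j.
Definition tilted (v : seq nat) (i : nat) : H := node (take i v) + io (tilt v) *: pen v i.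
Definition atom (v : seq nat) (l : K) : H :=
  \sum_(i < (size v).+1) (l ^+ i * io (weight v i)) *: tilted v i.

Definition orth_basis (z : H) : Prop :=
  (forall v, ip z (node v) = 0) /\
  (forall v i, (i <= size v)%N -> ip z (pen v i) = 0).

(** The second part is there for the density of the span: it contains the vectors
    of the sequence b that are not used by the curves, and the directions
    orthogonal to all of b. *)
Definition dict : set H :=
  [set g | (exists v l, absR l <= 1 /\ g = `|atom v l|^-1 *: atom v l)
           \/ (`|g| = 1 /\ orth_basis g)].

Lemma tilt_gt0 v : 0 < tilt v.
Proof. by rewrite invr_gt0 ltr0Sn. Qed.

Lemma tilt_le1 v : tilt v <= 1.
Proof. by rewrite invf_le1 ?ltr0Sn // ler1n. Qed.

Lemma ratio_gt0 v j : 0 < ratio v j.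
Proof. by rewrite divr_gt0 ?mulr_gt0 ?exprn_gt0 ?tilt_gt0 ?ltr0Sn. Qed.

Lemma ratio_le1 v j : ratio v j <= 1.
Proof.
have d1 : 1 <= 3 ^+ j.+1 * (nth 0%N v j).+1%:R :> R.
  by rewrite mulr_ege1 ?ler1n // exprn_ege1 // ler1n.
rewrite ler_pdivrMr ?mul1r; last by apply: lt_le_trans d1.
by apply: le_trans d1; rewrite expr_le1 ?tilt_le1 // ltW ?tilt_gt0.
Qed.

Lemma weightS v i : weight v i.+1 = weight v i * ratio v i.
Proof. by rewrite /weight big_ord_recr. Qed.

Lemma weight_gt0 v i : 0 < weight v i.
Proof. by apply: prodr_gt0 => j _; apply: ratio_gt0. Qed.

Lemma weight_anti v i j : (i <= j)%N -> weight v j <= weight v i.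
Proof.
move=> /subnK<-; elim: (j - i)%N => // k IH.
rewrite addSn weightS; apply: le_trans IH.
by rewrite ler_piMr ?ratio_le1 // ltW ?weight_gt0.
Qed.

(** The bound on the first coefficients gives moments of order j < size L at
    most B / weight v i, the weights being nonincreasing; [moment_growth] then
    bounds the next moment, and the ratio of weights cancels 3 ^ (i+1). *)
Lemma coef_decay v (L : seq (K * K)) (B : R) i :
  (forall q, q \in L -> absR q.2 <= 1) -> (size L <= i.+1)%N -> 0 <= B ->
  (forall j, (j < size L)%N -> weight v j * absR (moment L j) <= B) ->
  weight v i.+1 * absR (moment L i.+1) <= tilt v ^+ 2 / (nth 0%N v i).+1%:R * B.
Proof.
move=> L1 Li B0 LB; have di := weight_gt0 v i.
have : absR (moment L i.+1) <= 3 ^+ i.+1 * (B / weight v i).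
  rewrite -io_le -absRE rmorphM rmorphXn rmorph_nat; apply: moment_growth => [|q qL|j jL].
  - by rewrite -(rmorph0 io) io_le divr_ge0 // ltW.
  - by rewrite absRE -(rmorph1 io) io_le L1.
  rewrite absRE io_le ler_pdivlMr // mulrC; apply: le_trans (LB j jL).
  rewrite ler_wpM2r ?absR_ge0 // weight_anti //.
  by rewrite -ltnS (leq_trans jL).
rewrite weightS -(ler_pM2l (mulr_gt0 di (ratio_gt0 v i))) => /le_trans; apply.
rewrite /ratio le_eqVlt; apply/orP; left; apply/eqP.
have : weight v i != 0 by rewrite gt_eqF.
have n0 : (nth 0%N v i).+1%:R != 0 :> R by rewrite pnatr_eq0.
have t0 : 3 ^+ i.+1 != 0 :> R by rewrite expf_neq0 // pnatr_eq0.
move: (weight v i) (tilt v) (3 ^+ i.+1) (_%:R) n0 t0 => d t p n n0 p0 d0.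
by field; rewrite p0 d0 n0.
Qed.

Lemma ip_node_node v w : ip (node v) (node w) = (v == w)%:R.
Proof. by rewrite on (inj_eq (pcan_inj pickleK)) xpair_eqE eqxx andbT. Qed.

Lemma ip_pen_node v i w : ip (pen v i) (node w) = 0.
Proof. by rewrite on (inj_eq (pcan_inj pickleK)) xpair_eqE andbF. Qed.

Lemma ip_node_pen v w i : ip (node v) (pen w i) = 0.
Proof. by rewrite on (inj_eq (pcan_inj pickleK)) xpair_eqE andbF. Qed.

Lemma ip_pen_pen v i w j : ip (pen v i) (pen w j) = ((v == w) && (i == j))%:R.
Proof. by rewrite on (inj_eq (pcan_inj pickleK)) xpair_eqE eqSS. Qed.

Lemma ip_atom_node v l w : ip (atom v l) (node w) =
  if take (size w) v == w then l ^+ size w * io (weight v (size w)) else 0.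
Proof.
have tE i : ip (tilted v i) (node w) = (take i v == w)%:R.
  by rewrite ipDl ipZl ip_node_node ip_pen_node mulr0 addr0.
rewrite ip_suml; case: eqP => [tw|tw].
  have wv : (size w < (size v).+1)%N by rewrite ltnS -tw size_take_min geq_minr.
  rewrite (bigD1 (Ordinal wv)) //= ipZl tE tw eqxx mulr1 big1 ?addr0 // => i.
  rewrite -val_eqE /= => iw; rewrite ipZl tE.
  case: eqP => [ti|]; last by rewrite mulr0.
  by rewrite -ti size_takel ?eqxx // -ltnS in iw.
rewrite big1 // => i _; rewrite ipZl tE; case: eqP => [ti|]; last by rewrite mulr0.
by case: tw; rewrite -ti size_takel // -ltnS.
Qed.

Lemma ip_atom_pen v l w j : ip (atom v l) (pen w j) =
  if (v == w) && (j <= size v)%N then l ^+ j * io (weight v j) * io (tilt v) else 0.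
Proof.
have tF i : ip (tilted v i) (pen w j) = io (tilt v) * ((v == w) && (i == j))%:R.
  by rewrite ipDl ipZl ip_node_pen ip_pen_pen add0r.
rewrite ip_suml; case: ifP => [/andP[/eqP vw jv]|vj]; first subst w.
  rewrite (bigD1 (Ordinal (jv : (j < (size v).+1)%N))) //= ipZl tF !eqxx mulr1.
  rewrite big1 ?addr0 // => i; rewrite -val_eqE /= => /negPf ij.
  by rewrite ipZl tF ij andbF !mulr0.
rewrite big1 // => i _; rewrite ipZl tF.
case: eqP vj => [_|_ _]; last by rewrite !mulr0.
case: eqP => [<-|_ _]; last by rewrite !mulr0.
by rewrite -ltnS ltn_ord.
Qed.

Lemma atom_neq0 v l : atom v l != 0.
Proof.
apply/eqP => G0; have := ip_atom_node v l [::].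
rewrite G0 ip0l take0 eqxx expr0 /weight big_ord0 rmorph1 mul1r => /eqP.
by rewrite eq_sym oner_eq0.
Qed.


Lemma partition_first (T : eqType) (W : nmodType) (L : seq (seq nat * T))
  (f : seq nat * T -> W) :
  \sum_(p <- L) f p
  = \sum_(v <- undup [seq p.1 | p <- L]) \sum_(p <- L | p.1 == v) f p.
Proof.
rewrite (exchange_big_dep xpredT) //= big_seq [RHS]big_seq.
apply: eq_bigr => p pL; rewrite -big_filter.
rewrite (eq_filter (a2 := pred1 p.1)) => [|v /=]; last by rewrite eq_sym.
by rewrite filter_pred1_uniq ?undup_uniq ?big_seq1 // mem_undup map_f.
Qed.

(** * No combination does better *)

Section LowerBound.
Variables (x : H) (xs : nat -> R) (s : nat -> nat).
Hypothesis x_node : forall i, ip x (node (mkseq s i)) = io (xs i).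
Hypothesis x_pen : forall v i, (i <= size v)%N -> ip x (pen v i) = 0.
Hypothesis xs0 : forall i, 0 <= xs i.

Variables (L : seq (seq nat * (K * K))) (z : H).
Hypothesis L1 : forall q, q \in L -> absR q.2.2 <= 1.
Hypothesis zorth : orth_basis z.

(* An m-term combination, where a term of L is made of the node of a curve, the
   coefficient and the parameter on the curve, and where z collects the terms
   outside the curves. The coefficients a v i are those of y on the curve v. *)
Let y : H := \sum_(q <- L) q.2.1 *: atom q.1 q.2.2 + z.
Let V := undup [seq q.1 | q <- L].
Let Lv v := [seq q.2 | q <- L & q.1 == v].
Let a v i : K := io (weight v i) * moment (Lv v) i.
Let M v : R := Num.sqrt (\sum_(i < (size v).+1) absR (a v i) ^+ 2).

Lemma ip_comb_node w :
  ip y (node w) = \sum_(v <- V) (if take (size w) v == w then a v (size w) else 0).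
Proof.
rewrite ipDl (proj1 zorth) addr0 ip_suml partition_first.
apply: eq_bigr => v _; rewrite /a /moment /Lv big_map big_filter mulr_sumr.
case: ifP => vw; last first.
  by rewrite big1 // => q /eqP qv; rewrite ipZl ip_atom_node qv vw mulr0.
by apply: eq_bigr => q /eqP qv; rewrite ipZl ip_atom_node qv vw; ring.
Qed.

Lemma ip_comb_pen v j : (j <= size v)%N -> ip y (pen v j) = io (tilt v) * a v j.
Proof.
move=> jv; rewrite ipDl (proj2 zorth) // addr0 ip_suml (bigID (fun q => q.1 == v)) /=.
rewrite [X in _ + X]big1 ?addr0 => [|q /negPf qv]; last first.
  by rewrite ipZl ip_atom_pen qv mulr0.
rewrite /a /moment /Lv big_map big_filter !mulr_sumr.
by apply: eq_bigr => q /eqP qv; rewrite ipZl ip_atom_pen qv eqxx jv /=; ring.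
Qed.

(** Bessel's inequality for the node vectors of the branch and all the penalty
    vectors of the curves used. *)
Lemma bessel_comb I :
  \sum_(i < I) absR (ip (x - y) (node (mkseq s i))) ^+ 2
    + \sum_(v <- V) (tilt v * M v) ^+ 2 <= nrm (x - y) ^+ 2.
Proof.
pose S1 := [seq (mkseq s i, 0%N) | i <- index_iota 0 I].
pose S2 := [seq (v, i.+1) | v <- V, i <- index_iota 0 (size v).+1].
have uS : uniq (S1 ++ S2).
  rewrite cat_uniq; apply/and3P; split.
  - rewrite map_inj_uniq ?iota_uniq // => i j [/(congr1 size)].
    by rewrite !size_mkseq.
  - apply/hasPn => _ /allpairsPdep[v [i [_ _ ->]]]; apply/negP.
    by case/mapP => j _ [].
  - apply: allpairs_uniq_dep => [|v _|]; rewrite ?undup_uniq ?iota_uniq //.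
    by move=> [v i] [w j] _ _ /= [-> ->].
apply: le_trans (bessel (b := fun t => b (pickle t)) (x - y) uS _); last first.
  by move=> t u _ _; rewrite on (inj_eq (pcan_inj pickleK)).
rewrite big_cat /= big_map big_allpairs_dep /= big_mkord.
rewrite lerD2l le_eqVlt; apply/orP; left; apply/eqP.
apply: eq_bigr => v _; rewrite exprMn sqr_sqrtr; last first.
  by apply: sumr_ge0 => i _; rewrite sqr_ge0.
rewrite big_mkord mulr_sumr.
apply: eq_bigr => i _; have iv : (i <= size v)%N by rewrite -ltnS.
rewrite pickle_pen ipBl x_pen // ip_comb_pen // sub0r absRN absRM exprMn.
by rewrite absR_io // ltW ?tilt_gt0.
Qed.

(** This is [loss_le_penalty] with tau i = 1 / (s (i-1) + 1): a curve v that
    meets the branch s at level i has the entry s (i-1) at i-1, so [coef_decay]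
    bounds its i-th coefficient by tau i * tilt v ^ 2 * M v. *)
Lemma dist_combination_ge m I (kappa : R) :
  (0 < m <= I)%N -> size L = m ->
  \sum_(m <= i < I) 2 * xs i * (s i.-1).+1%:R^-1 <= kappa ->
  m%:R * kappa <= xs 0%N / 2 -> m%:R * kappa <= xs m.-1 / 2 -> 0 <= kappa ->
  \sum_(m <= i < I) xs i ^+ 2 <= nrm (x - y) ^+ 2.
Proof.
move=> mI szL Hk Hk0 Hkm k0; apply: le_trans (bessel_comb I).
pose A v i := if take i v == mkseq s i then absR (a v i) else 0.
have Mge v i : (i <= size v)%N -> absR (a v i) <= M v.
  move=> iv; rewrite -(@ler_pXn2r _ 2) ?nnegrE ?absR_ge0 ?sqrtr_ge0 //.
  rewrite sqr_sqrtr; last by apply: sumr_ge0 => j _; rewrite sqr_ge0.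
  rewrite (bigD1 (Ordinal (iv : (i < (size v).+1)%N))) //= lerDl.
  by apply: sumr_ge0 => j _; rewrite sqr_ge0.
have take_size v i : take i v == mkseq s i -> (i <= size v)%N.
  by move=> /eqP tv; rewrite -(size_mkseq s i) -tv size_take_min geq_minr.
have LvL q v : q \in Lv v -> absR q.2 <= 1.
  by case/mapP => p; rewrite mem_filter => /andP[_ pL] ->; apply: L1.
have szLv v : (size (Lv v) <= m)%N.
  by rewrite size_map size_filter -szL count_size.
apply: (@loss_le_penalty R (seq nat) V tilt M A (fun v => size (Lv v)) xs
  (fun i => (s i.-1).+1%:R^-1) (fun i => absR (ip (x - y) (node (mkseq s i)))) m I
  kappa mI) => //.
- by rewrite -szL -(size_map fst) size_undup.
- by move=> v _; rewrite tilt_gt0 tilt_le1 sqrtr_ge0 szLv.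
- move=> v i _; rewrite /A; case: ifP => [/take_size iv|_].
    by rewrite absR_ge0 Mge.
  by rewrite lexx sqrtr_ge0.
- move=> v i vV ri; rewrite /A.
  have rhs0 : 0 <= (s i.-1).+1%:R^-1 * (tilt v ^+ 2 * M v).
    apply: mulr_ge0; first by rewrite invr_ge0 ler0n.
    by apply: mulr_ge0; [rewrite sqr_ge0|rewrite sqrtr_ge0].
  case: ifP => // tv; have iv := take_size v i tv.
  case: i ri tv iv rhs0 => [|i] ri tv iv rhs0.
    move: vV ri; rewrite mem_undup => /mapP[q qL qv].
    rewrite leqn0 size_map size_filter -leqn0 leqNgt -has_count.
    by move=> /hasPn /(_ _ qL); rewrite qv eqxx.
  rewrite /a absRM (absR_io (ltW (weight_gt0 v _))).
  have -> : (s i.+1.-1).+1%:R^-1 * (tilt v ^+ 2 * M v)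
          = tilt v ^+ 2 / (nth 0%N v i).+1%:R * M v.
    have -> : nth 0%N v i = s i.
      rewrite -(nth_mkseq 0%N s (ltnSn i)) -(eqP tv) nth_take //.
    by rewrite /=; ring.
  apply: coef_decay => //; first by move=> q; apply: LvL.
    exact: sqrtr_ge0.
  move=> j jr; rewrite -[weight v j](absR_io (ltW (weight_gt0 v j))) -absRM.
  by apply: Mge; apply: leq_trans iv; apply: ltnW; apply: leq_trans ri.
- by move=> i; apply: absR_ge0.
- move=> i; have := absRD (ip (x - y) (node (mkseq s i))) (ip y (node (mkseq s i))).
  rewrite {1}ipBl subrK x_node absR_io // => h.
  rewrite lerBlDr; apply: le_trans h _; rewrite lerD2l ip_comb_node size_mkseq.
  apply: le_trans (absR_sum _ _ _) _; apply: ler_sum => v _; rewrite /A.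
  by case: ifP => // _; rewrite absR0.
- have [[v vV rv]|nov] := pselect (exists2 v, v \in V & size (Lv v) = m).
    left; exists v.
    have Vv w : w \in V -> w = v.
      rewrite mem_undup => /mapP[q qL ->].
      have : all (fun q => q.1 == v) L.
        by rewrite all_count -size_filter -(size_map snd) [size _]rv szL.
      by move/allP/(_ _ qL)/eqP.
    have : (size V <= 1)%N.
      apply: (@uniq_leq_size _ V [:: v]); first exact: undup_uniq.
      by move=> w /Vv->; rewrite mem_head.
    move: vV Vv; case: V => [|w [|]] // _ Vv _.
    by rewrite (Vv w) // mem_head.
  right=> v vV; rewrite ltn_neqAle szLv andbT; apply/eqP => rv.
  by apply: nov; exists v.
- by rewrite invf_le1 ?ltr0Sn // ler1n.
Qed.

End LowerBound.

(** * Some combinations do almost as well *)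

Lemma combination_tilted v (T : Type) (r : seq T) (f g : T -> K) :
  \sum_(k <- r) f k *: atom v (g k)
  = \sum_(i < (size v).+1)
      (io (weight v i) * moment [seq (f k, g k) | k <- r] i) *: tilted v i.
Proof.
under eq_bigr do rewrite scaler_sumr.
rewrite exchange_big /=; apply: eq_bigr => i _.
rewrite /moment big_map mulr_sumr scaler_suml; apply: eq_bigr => k _.
by rewrite scalerA; congr (_ *: _) => /=; ring.
Qed.

(** The first m coefficients on a curve can be prescribed with m elements,
    by interpolation of moments, and the remaining ones are then small by
    [coef_decay]. *)
Lemma combination_prescribed v m (p : nat -> K) : exists f : 'I_m -> K,
  exists a : nat -> K,
  [/\ \sum_k f k *: atom v (k.+1%:R^-1) = \sum_(i < (size v).+1) a i *: tilted v i,
      forall i, (i < m)%N -> a i = p i &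
      forall B i, (m <= i.+1)%N -> 0 <= B ->
        (forall j, (j < m)%N -> absR (p j) <= B) ->
        absR (a i.+1) <= tilt v ^+ 2 / (nth 0%N v i).+1%:R * B].
Proof.
have iod i : io (weight v i) != 0.
  by rewrite -(rmorph0 io) (inj_eq (can_inj ioK)) gt_eqF ?weight_gt0.
have [f fp] := moment_interpolation m (fun i => p i / io (weight v i)).
pose L := [seq (f k, k.+1%:R^-1 : K) | k <- index_enum 'I_m].
have ap i : (i < m)%N -> io (weight v i) * moment L i = p i.
  by move=> im; rewrite /moment big_map fp // mulrC divfK.
have szL : size L = m by rewrite size_map -[RHS]card_ord cardT enumT.
exists f, (fun i => io (weight v i) * moment L i); split=> //.
  exact: combination_tilted.
move=> B i mi B0 pB; rewrite absRM absR_io ?(ltW (weight_gt0 v _)) //.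
apply: coef_decay => //; rewrite ?szL //.
  move=> _ /mapP[k _ ->] /=.
  by rewrite -io_le -absRE rmorph1 normfV normr_nat invf_le1 ?ler1n ?ltr0Sn.
move=> j jm; rewrite -[weight v j](absR_io (ltW (weight_gt0 v j))) -absRM ap //.
exact: pB.
Qed.

Lemma nrm_node v : nrm (node v) = 1.
Proof. by rewrite nrm_unit // ip_node_node eqxx. Qed.

Lemma nrm_pen v i : nrm (pen v i) = 1.
Proof. by rewrite nrm_unit // ip_pen_pen !eqxx. Qed.

Lemma nrm_tilted v i : nrm (tilted v i) <= 2.
Proof.
apply: le_trans (nrmD _ _) _; rewrite nrmZ nrm_node nrm_pen mulr1.
by rewrite absR_io ?(ltW (tilt_gt0 v)) //; have := tilt_le1 v; lra.
Qed.

Lemma take_mkseq (s : nat -> nat) i n : (i <= n)%N ->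
  take i (mkseq s n) = mkseq s i.
Proof. by move=> /minn_idPl i_n; rewrite /mkseq -map_take take_iota i_n. Qed.

(** On the curve of the node of length N of the branch, prescribing the coefficients
    xs i for i < m leaves two errors: the tilt, at most X / (N+1) with
    X = sum_(i<m) xs i, and the N + 1 - m remaining coefficients, each at most
    X / (N+1) ^ 2 on vectors of norm at most 2. *)
Lemma near_best_combination (x : H) (xs : nat -> R) (s : nat -> nat) m N :
  (forall i, 0 <= xs i) -> (0 < m <= N)%N ->
  exists f : 'I_m -> K,
    nrm (x - \sum_k f k *: atom (mkseq s N) (k.+1%:R^-1))
    <= nrm (x - \sum_(i < m) io (xs i) *: node (mkseq s i))
       + 3 * (\sum_(i < m) xs i) / N.+1%:R.
Proof.
move=> xs0 /andP[m0 mN]; set v := mkseq s N; set X := \sum_(i < m) xs i.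
have X0 : 0 <= X by apply: sumr_ge0.
have [f [a [fa am abound]]] := combination_prescribed v m (fun i => io (xs i)).
have szv : size v = N by rewrite size_mkseq.
exists f; rewrite fa szv.
have thE : tilt v = N.+1%:R^-1 by rewrite /tilt szv.
have absRX i : (m <= i)%N -> absR (a i) <= tilt v ^+ 2 * X.
  case: i => [|i] mi; first by rewrite leqNgt m0 in mi.
  apply: le_trans (abound X i mi X0 _) _ => [j jm|].
    by rewrite absR_io // /X (bigD1 (Ordinal jm)) //= lerDl sumr_ge0.
  by rewrite ler_wpM2r // ler_piMr ?sqr_ge0 // invf_le1 ?ler1n ?ltr0Sn.
have mN1 : (m <= N.+1)%N by apply: leqW.
set x0 := \sum_(i < m) io (xs i) *: node (mkseq s i).
pose e1 := \sum_(i < m) (io (xs i) * io (tilt v)) *: pen v i.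
pose e2 := \sum_(m <= i < N.+1) a i *: tilted v i.
have -> : x - \sum_(i < N.+1) a i *: tilted v i = (x - x0) - e1 - e2.
  rewrite -!(addrA x) -!opprD; congr (_ - _).
  rewrite -(big_mkord xpredT (fun i => a i *: tilted v i)) (big_cat_nat _ mN1) //=.
  congr (_ + _); rewrite big_mkord /x0 /e1 -big_split /=; apply: eq_bigr => i _.
  rewrite am // /tilted scalerDr scalerA take_mkseq //.
  exact: leq_trans (ltnW (ltn_ord i)) mN.
have e1X : nrm e1 <= tilt v * X.
  apply: le_trans (nrm_sum _ _ _) _; rewrite /X mulr_sumr; apply: ler_sum => i _.
  by rewrite nrmZ nrm_pen mulr1 absRM !absR_io ?(ltW (tilt_gt0 v)) // mulrC.
have e2X : nrm e2 <= 2 * tilt v * X.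
  apply: le_trans (nrm_sum _ _ _) _.
  apply: (@le_trans _ _ (\sum_(m <= i < N.+1) tilt v ^+ 2 * X * 2)).
    rewrite big_nat [leRHS]big_nat; apply: ler_sum => i /andP[mi _].
    by rewrite nrmZ ler_pM ?absR_ge0 ?nrm_ge0 ?absRX ?nrm_tilted.
  rewrite sumr_const_nat -mulr_natl.
  have : (N.+1 - m)%:R <= (tilt v)^-1 by rewrite thE invrK ler_nat leq_subr.
  rewrite -(ler_pM2r (tilt_gt0 v)) mulVf ?gt_eqF ?tilt_gt0 // => h.
  have tX : 0 <= tilt v * X by rewrite mulr_ge0 // ltW ?tilt_gt0.
  have := ler_wpM2r tX h; nra.
apply: le_trans (nrmD _ _) _; rewrite nrmN.
apply: (@le_trans _ _ (nrm (x - x0) + nrm e1 + nrm e2)).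
  by rewrite lerD2r; apply: le_trans (nrmD _ _) _; rewrite nrmN.
by rewrite -thE; lra.
Qed.

(** * The element attached to a sequence *)

Lemma choose_branch (xs : nat -> R) : (forall i, 0 < xs i) ->
  exists s : nat -> nat, forall m I, (0 < m)%N ->
    let kappa := \sum_(m <= i < I) 2 * xs i * (s i.-1).+1%:R^-1 in
    m%:R * kappa <= xs 0%N / 2 /\ m%:R * kappa <= xs m.-1 / 2.
Proof.
move=> xs0.
(* Z i is at least m / xs 0 and m / xs (m-1) for all m with 0 < m <= i, and the
   branch makes the i-th term of kappa times Z i at most 2 ^ (-i) / 2; so the terms from
   m on add up to at most 1 / 2. *)
pose Z i : R := \sum_(j < i) j.+1%:R / xs j + i%:R / xs 0%N.
have Zterm j : 0 <= j.+1%:R / xs j by rewrite divr_ge0 // ltW.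
have Z0 i : 0 <= Z i.
  by rewrite addr_ge0 ?sumr_ge0 // divr_ge0 // ltW.
pose y i : R := 4 * xs i * Z i * 2 ^+ i.
exists (fun j => Num.bound (y j.+1)) => m I m0 kappa.
have small i : (0 < i)%N ->
    2 * xs i * (Num.bound (y i.-1.+1)).+1%:R^-1 * Z i <= (2^-1) ^+ i / 2.
  move=> i0; rewrite prednK //.
  have y0 : 0 <= y i.
    by rewrite /y !mulr_ge0 ?exprn_ge0 // ltW.
  have yb : y i <= (Num.bound (y i)).+1%:R.
    by apply: ltW; apply: lt_trans (archi_boundP y0) _; rewrite ltr_nat.
  have p2 : 0 < 2 ^+ i :> R by rewrite exprn_gt0.
  rewrite mulrAC ler_pdivrMr ?ltr0Sn // exprVn.
  rewrite [leRHS]mulrAC ler_pdivlMr // [leRHS]mulrC ler_pdivlMr //.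
  by apply: le_trans yb; rewrite /y; lra.
have geom n : \sum_(1 <= i < n.+1) (2^-1 : R) ^+ i = 1 - (2^-1) ^+ n.
  elim: n => [|n IH]; first by rewrite big_geq // expr0 subrr.
  by rewrite big_nat_recr //= IH exprS; lra.
have geom1 : \sum_(m <= i < I) (2^-1 : R) ^+ i <= 1.
  have [Im|mI] := leqP I m; first by rewrite big_geq.
  have := geom I.-1; rewrite (ltn_predK mI) (big_cat_nat m0 (ltnW mI)) /=.
  have : 0 <= \sum_(1 <= i < m) (2^-1 : R) ^+ i.
    by apply: sumr_ge0 => i _; rewrite exprn_ge0 // invr_ge0.
  have : 0 <= (2^-1 : R) ^+ I.-1 by rewrite exprn_ge0 // invr_ge0.
  lra.
have main c : 0 < c -> (forall i, (m <= i)%N -> m%:R / c <= Z i) ->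
    m%:R * kappa <= c / 2.
  move=> c0 cZ.
  have : \sum_(m <= i < I) m%:R / c * (2 * xs i * (Num.bound (y i.-1.+1)).+1%:R^-1)
         <= \sum_(m <= i < I) (2^-1) ^+ i / 2.
    rewrite big_nat [leRHS]big_nat; apply: ler_sum => i /andP[mi _].
    apply: le_trans (small i (leq_trans m0 mi)).
    rewrite mulrC ler_wpM2l ?cZ // mulr_ge0 ?invr_ge0 ?ler0n // mulr_ge0 //.
    exact: ltW.
  rewrite -mulr_sumr -mulr_suml -/kappa => h.
  have : m%:R / c * kappa <= 2^-1 by move: h geom1; lra.
  by rewrite mulrAC ler_pdivrMr // => h'; move: h'; lra.
split; apply: main => // i mi.
  apply: le_trans (_ : i%:R / xs 0%N <= _).
    by rewrite ler_wpM2r ?ler_nat // invr_ge0 ltW.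
  by rewrite lerDr sumr_ge0.
have mi' : (m.-1 < i)%N by rewrite prednK.
rewrite /Z (bigD1 (Ordinal mi')) //= prednK // -addrA lerDl addr_ge0 //.
  exact: sumr_ge0.
by rewrite divr_ge0 // ltW.
Qed.

Section Realize.
Variable alpha : nat -> R.
Hypothesis alpha_lt : forall m, alpha m.+1 < alpha m.
Hypothesis alpha_cvg : alpha @ \oo --> 0.

Lemma alpha_small e : 0 < e -> exists N, forall n, (N <= n)%N -> alpha n < e.
Proof.
move=> e0; move/cvgrPdist_lt: alpha_cvg => /(_ _ e0)[N _ NP]; exists N => n Nn.
by have := NP n Nn; rewrite sub0r normrN; apply: le_lt_trans; apply: ler_norm.
Qed.

Lemma alpha_gt0 n : 0 < alpha n.
Proof.
have anti i j : (i <= j)%N -> alpha j <= alpha i.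
  move=> /subnK<-; elim: (j - i)%N => // k IH.
  by apply: le_trans IH; apply: ltW; apply: alpha_lt.
suff : 0 <= alpha n.+1 by move=> /le_lt_trans; apply; apply: alpha_lt.
rewrite leNgt; apply/negP => a0.
have := @alpha_cvg; move/cvgrPdist_lt => /(_ (- alpha n.+1)).
rewrite oppr_gt0 => /(_ a0) [N _ NP].
have := NP (maxn N n.+1) (leq_maxl _ _); rewrite sub0r => h.
have := le_lt_trans (ler_norm _) h; rewrite ltrN2 ltNge anti //.
exact: leq_maxr.
Qed.

Let xs i := Num.sqrt (alpha i ^+ 2 - alpha i.+1 ^+ 2).

Lemma drop_gt0 i : 0 < alpha i ^+ 2 - alpha i.+1 ^+ 2.
Proof. by rewrite subr_gt0 ltr_pXn2r ?nnegrE ?alpha_lt // ltW ?alpha_gt0. Qed.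

Lemma xs_gt0 i : 0 < xs i. Proof. by rewrite sqrtr_gt0 drop_gt0. Qed.

Lemma sum_xs_sq m n : (m <= n)%N ->
  \sum_(m <= i < n) xs i ^+ 2 = alpha m ^+ 2 - alpha n ^+ 2.
Proof.
move=> mn; rewrite -[RHS]opprB -(telescope_sumr (fun i => alpha i ^+ 2) mn) -sumrN.
apply: eq_bigr => i _.
by rewrite /xs sqr_sqrtr ?opprB // ltW // drop_gt0.
Qed.

(** The distance from x to its m-th partial sum is alpha m because its square is the
    tail of the series of the xs i ^ 2, which telescopes. *)
Lemma element_with_drops (s : nat -> nat) : exists x : H,
  [/\ forall i, ip x (node (mkseq s i)) = io (xs i),
      forall v i, ip x (pen v i) = 0 &
      forall m, nrm (x - \sum_(i < m) io (xs i) *: node (mkseq s i)) = alpha m].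
Proof.
pose e i := node (mkseq s i).
have one i j : ip (e i) (e j) = (i == j)%:R.
  rewrite ip_node_node; congr ((_ : bool)%:R); apply/eqP/eqP => [|->] //.
  by move=> /(congr1 size); rewrite !size_mkseq.
have absR_xs i : absR (io (xs i)) = xs i by rewrite absR_io // ltW // xs_gt0.
have sq m n : (m <= n)%N ->
    \sum_(m <= i < n) absR (io (xs i)) ^+ 2 = alpha m ^+ 2 - alpha n ^+ 2.
  by move=> mn; rewrite -sum_xs_sq //; apply: eq_bigr => i _; rewrite absR_xs.
have [|x xP] := orthonormal_series one (c := fun i => io (xs i)) (B := alpha 0%N ^+ 2).
  move=> n; rewrite -(big_mkord xpredT (fun i => absR (io (xs i)) ^+ 2)) sq //.
  by rewrite gerBl sqr_ge0.
exists x; split=> [i|v i|m].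
- exact: (@ip_series e (fun i => io (xs i)) one x xP i).
- apply: (@ip_series_orth e (fun i => io (xs i)) x xP); first by rewrite ip_pen_pen !eqxx.
  by move=> j; apply: ip_node_pen.
pose S n := \sum_(i < n) io (xs i) *: e i.
rewrite -/(S m); apply/eqP; rewrite eq_le; apply/andP; split.
  apply/ler_addgt0Pr => eps eps0; have [N NP] := xP eps eps0.
  set n := maxn N m; have := NP n (leq_maxl _ _); rewrite -/(S n) => h.
  have mn : (m <= n)%N by apply: leq_maxr.
  have SS : nrm (S n - S m) <= alpha m.
    rewrite -(@ler_pXn2r _ 2) ?nnegrE ?nrm_ge0 ?(ltW (alpha_gt0 m)) //.
    by rewrite (@nrm_partial e (fun i => io (xs i)) one) // sq // gerBl sqr_ge0.
  have := nrmD (x - S n) (S n - S m); rewrite addrA subrK; lra.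
apply/ler_addgt0Pr => eps eps0.
have e20 : 0 < eps / 2 by rewrite divr_gt0.
have [N NP] := xP _ e20; have [N' NP'] := alpha_small e20.
set n := maxn m (maxn N N').
have mn : (m <= n)%N by apply: leq_maxl.
have := NP n; rewrite /n !leq_max leqnn orbT => /(_ isT); rewrite -/n -/(S n) => h.
have := NP' n; rewrite /n !leq_max leqnn !orbT => /(_ isT); rewrite -/n => h'.
have SS : alpha m - alpha n <= nrm (S n - S m).
  have [|am] := leP (alpha m - alpha n) 0.
    by move=> /le_trans; apply; apply: nrm_ge0.
  rewrite -(@ler_pXn2r _ 2) ?nnegrE ?nrm_ge0 ?(ltW am) //.
  rewrite (@nrm_partial e (fun i => io (xs i)) one) // sq //.
  by have := mulr_gt0 (alpha_gt0 n) am; rewrite !expr2; lra.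
have := nrmD (S n - x) (x - S m); rewrite addrA subrK (nrmB (S n) x); lra.
Qed.

End Realize.

Lemma Sigma_atoms (T : Type) (r : seq T) m (f g : T -> K) v :
  size r = m -> (forall k, absR (g k) <= 1) ->
  Sigma m dict (\sum_(k <- r) f k *: atom v (g k)).
Proof.
move=> <- g1; exists (fun k => f (tnth (in_tuple r) k) * `|atom v (g (tnth (in_tuple r) k))|).
exists (fun k => `|atom v (g (tnth (in_tuple r) k))|^-1 *: atom v (g (tnth (in_tuple r) k))).
split=> [k|]; first by left; exists v, (g (tnth (in_tuple r) k)).
rewrite [LHS]big_tnth; apply: eq_bigr => k _.
by rewrite scalerA -mulrA mulfV ?mulr1 // normr_eq0 atom_neq0.
Qed.

(** A term outside the curves is moved to z, and is counted as the zero multiple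
    of an element of the curve of the root, so that L keeps size m. *)
Lemma Sigma_dictE m y : Sigma m dict y ->
  exists L z, [/\ size L = m, forall q, q \in L -> absR q.2.2 <= 1, orth_basis z &
    y = \sum_(q <- L) q.2.1 *: atom q.1 q.2.2 + z].
Proof.
move=> [c [g [gD ->]]].
have gP k : exists q : (seq nat * (K * K)) * H,
    [/\ absR q.1.2.2 <= 1, orth_basis q.2 & c k *: g k = q.1.2.1 *: atom q.1.1 q.1.2.2 + q.2].
  have [[v [l [l1 ->]]]|[_ og]] := gD k.
    exists ((v, (c k * `|atom v l|^-1, l)), 0) => /=; split=> //.
      by split=> *; rewrite ip0l.
    by rewrite addr0 scalerA.
  exists (([::], (0, 0)), c k *: g k) => /=; split; first by rewrite absR0.
    by split=> *; rewrite ipZl ?(proj1 og) ?(proj2 og) // mulr0.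
  by rewrite scale0r add0r.
have [q qP] := choice gP.
exists [seq (q k).1 | k <- index_enum 'I_m], (\sum_k (q k).2); split.
- by rewrite size_map -[RHS]card_ord cardT enumT.
- by move=> _ /mapP[k _ ->]; case: (qP k).
- split=> *; rewrite ip_suml big1 // => k _; case: (qP k) => _ [oE oF] _.
    exact: oE.
  exact: oF.
rewrite big_map -big_split /=; apply: eq_bigr => k _.
by case: (qP k).
Qed.

Lemma dict_attains_deviations : forall alpha : R^nat,
  (forall m, alpha m.+1 < alpha m) -> alpha @ \oo --> 0 ->
  exists x : H, forall m, sigma re dict m x = alpha m.
Proof.
move=> alpha lt_alpha cvg_alpha.
pose xs i := Num.sqrt (alpha i ^+ 2 - alpha i.+1 ^+ 2).
have xs0 i : 0 < xs i := xs_gt0 lt_alpha cvg_alpha i.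
have [s sP] := choose_branch xs0.
have [x [x_node x_pen xm]] := element_with_drops lt_alpha cvg_alpha s.
exists x => -[|m].
  by rewrite -xm big_ord0 subr0.
rewrite /= /dist; set S := [set _ | _ in _].
have agt0 := alpha_gt0 lt_alpha cvg_alpha.
(* For every I >= m+1 the squared distance is at least
   alpha (m+1) ^ 2 - alpha I ^ 2, and alpha I tends to 0. *)
have lb : lbound S (alpha m.+1).
  move=> _ [y /Sigma_dictE[L [z [szL L1 zo ->]]] <-].
  set nn := nrm _.
  have nn0 : 0 <= nn by apply: nrm_ge0.
  apply/ler_addgt0Pr => e e0.
  have [N NP] := alpha_small cvg_alpha e0.
  set I := maxn N m.+1; have aI : alpha I < e by apply: NP; apply: leq_maxl.
  have mI : (m.+1 <= I)%N by apply: leq_maxr.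
  have [h0 hm] := sP m.+1 I isT.
  have k0 : 0 <= \sum_(m.+1 <= i < I) 2 * xs i * (s i.-1).+1%:R^-1.
    apply: sumr_ge0 => i _; rewrite mulr_ge0 ?invr_ge0 ?ler0n // mulr_ge0 //.
    exact: ltW.
  have := @dist_combination_ge x xs s x_node (fun v i _ => x_pen v i) (fun i => ltW (xs0 i))
    L z L1 zo m.+1 I _ mI szL (lexx _) h0 hm k0.
  rewrite sum_xs_sq // -/nn => h; have := agt0 I; have := agt0 m.+1.
  rewrite leNgt => a1 a2; apply/negP => a3.
  have := mulr_gt0 a2 a2; nra.
apply/eqP; rewrite eq_le; apply/andP; split; last first.
  apply: lb_le_inf => //.
  exists (nrm (x - 0)), 0 => //; exists (fun=> 0), (fun=> `|atom [::] 0|^-1 *: atom [::] 0).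
  split=> [k|]; first by left; exists [::], 0; rewrite absR0.
  by rewrite big1 // => k _; rewrite scale0r.
apply/ler_addgt0Pr => e e0.
set X := \sum_(i < m.+1) xs i.
have X0 : 0 <= 3 * X / e.
  by rewrite divr_ge0 ?(ltW e0) // mulr_ge0 // sumr_ge0 // => i _; apply: ltW.
set N := maxn (Num.bound (3 * X / e)) m.+1.
have XN : 3 * X / N.+1%:R <= e.
  rewrite ler_pdivrMr ?ltr0Sn // [leRHS]mulrC -ler_pdivrMr //.
  apply: ltW; apply: lt_le_trans (archi_boundP X0) _.
  by rewrite ler_nat leqW // leq_maxl.
have [f fP] := @near_best_combination x xs s m.+1 N (fun i => ltW (xs0 i)) (leq_maxr _ _).
rewrite xm in fP; apply: le_trans (_ : _ <= alpha m.+1 + 3 * X / N.+1%:R) _; last first.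
  by rewrite lerD2l.
apply: le_trans fP; apply: ge_inf; first by exists (alpha m.+1).
exists (\sum_(k < m.+1) f k *: atom (mkseq s N) (k.+1%:R^-1)) => //.
apply: Sigma_atoms; first by rewrite -[RHS]card_ord cardT enumT.
move=> k; rewrite -io_le -absRE rmorph1 normfV normr_nat.
by rewrite invf_le1 ?ler1n ?ltr0Sn.
Qed.

(** * Density of the span *)

Lemma lspan_dict g : dict g -> lspan dict g.
Proof.
move=> gD; exists 1%N, (fun=> 1), (fun=> g); split=> //.
by rewrite big_ord1 scale1r.
Qed.

Lemma lspanD y z : lspan dict y -> lspan dict z -> lspan dict (y + z).
Proof.
move=> [m [c [g [gD ->]]]] [n [c' [g' [gD' ->]]]]; exists (m + n)%N.
exists (fun k => match fintype.split k with inl i => c i | inr j => c' j end).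
exists (fun k => match fintype.split k with inl i => g i | inr j => g' j end).
split=> [k|]; first by case: (fintype.split k) => i.
rewrite big_split_ord /=; congr (_ + _); apply: eq_bigr => i _.
  by rewrite (unsplitK (inl i)).
by rewrite (unsplitK (inr i)).
Qed.

Lemma lspanZ a y : lspan dict y -> lspan dict (a *: y).
Proof.
move=> [m [c [g [gD ->]]]]; exists m, (fun k => a * c k), g; split=> //.
by rewrite scaler_sumr; apply: eq_bigr => k _; rewrite scalerA.
Qed.

(** The closure of the span, with radii in R. *)
Definition approx (y : H) : Prop :=
  forall e : R, 0 < e -> exists2 z, lspan dict z & nrm (y - z) < e.

Lemma approx_lspan y : lspan dict y -> approx y.
Proof. by move=> ly e e0; exists y; rewrite // subrr nrm0. Qed.

Lemma approxD y z : approx y -> approx z -> approx (y + z).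
Proof.
move=> ay az e e0; have e20 : 0 < e / 2 by rewrite divr_gt0.
have [y' ly yy'] := ay _ e20; have [z' lz zz'] := az _ e20.
exists (y' + z'); first exact: lspanD.
by rewrite opprD addrACA; apply: le_lt_trans (nrmD _ _) _; lra.
Qed.

Lemma approxZ a y : approx y -> approx (a *: y).
Proof.
move=> ay e e0; have p : 0 < absR a + 1 by have := absR_ge0 a; lra.
have [y' ly yy'] := ay _ (divr_gt0 e0 p); exists (a *: y'); first exact: lspanZ.
rewrite -scalerBr nrmZ; apply: (@le_lt_trans _ _ ((absR a + 1) * nrm (y - y'))).
  by rewrite ler_wpM2r ?nrm_ge0 // lerDl.
by rewrite mulrC -ltr_pdivlMr.
Qed.

Lemma approx_sum (T : Type) (r : seq T) (P : pred T) (f : T -> H) :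
  (forall i, P i -> approx (f i)) -> approx (\sum_(i <- r | P i) f i).
Proof.
move=> af; elim/big_ind : _ => //; last exact: approxD.
apply: approx_lspan; exists 0%N, (fun=> 0), (fun=> 0).
by split=> [[]|] //; rewrite big_ord0.
Qed.

Lemma approx_lim y : (forall e : R, 0 < e -> exists2 z, approx z & nrm (y - z) < e) ->
  approx y.
Proof.
move=> ay e e0; have e20 : 0 < e / 2 by rewrite divr_gt0.
have [z az yz] := ay _ e20; have [z' lz zz'] := az _ e20; exists z' => //.
by have := nrmD (y - z) (z - z'); rewrite addrA subrK; lra.
Qed.

Lemma approx_tilted v i : (i <= size v)%N -> approx (tilted v i).
Proof.
move=> iv; have [f [a [fa ap _]]] :=
  combination_prescribed v (size v).+1 (fun j => (j == i)%:R).
apply: approx_lspan; exists (size v).+1.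
have -> : tilted v i = \sum_k f k *: atom v (k.+1%:R^-1).
  rewrite fa (bigD1 (Ordinal (iv : (i < (size v).+1)%N))) //= ap //.
  rewrite eqxx scale1r big1 ?addr0 // => j; rewrite -val_eqE /= => /negPf ji.
  by rewrite ap // ji scale0r.
apply: Sigma_atoms; first by rewrite -[RHS]card_ord cardT enumT.
move=> k; rewrite -io_le -absRE rmorph1 normfV normr_nat.
by rewrite invf_le1 ?ler1n ?ltr0Sn.
Qed.

(** The node w is a prefix of arbitrarily long nodes v, whose tilt tends to 0. *)
Lemma approx_node w : approx (node w).
Proof.
apply: approx_lim => e e0.
pose v := w ++ nseq (Num.bound e^-1) 0%N.
have wv : (size w <= size v)%N by rewrite size_cat leq_addr.
exists (tilted v (size w)); first exact: approx_tilted.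
rewrite /tilted take_size_cat // opprD addrA subrr sub0r nrmN nrmZ nrm_pen mulr1.
rewrite absR_io ?(ltW (tilt_gt0 _)) // /tilt size_cat size_nseq.
rewrite invf_plt ?posrE ?ltr0Sn //.
have ei0 : 0 <= e^-1 by rewrite invr_ge0 ltW.
by apply: lt_trans (archi_boundP ei0) _; rewrite ltr_nat ltnS leq_addl.
Qed.

Lemma approx_pen v i : (i <= size v)%N -> approx (pen v i).
Proof.
move=> iv; have th0 : io (tilt v) != 0.
  by rewrite -(rmorph0 io) (inj_eq (can_inj ioK)) gt_eqF ?tilt_gt0.
have -> : pen v i = (io (tilt v))^-1 *: (tilted v i + (-1) *: node (take i v)).
  by rewrite scaleN1r /tilted addrAC subrr add0r scalerA mulVf // scale1r.
apply/approxZ/approxD; first exact: approx_tilted.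
exact/approxZ/approx_node.
Qed.

Lemma approx_b n : approx (b n).
Proof.
have [[[v [|i]] vn]|no] := pselect (exists t : seq nat * nat, pickle t = n).
- by rewrite -vn; apply: approx_node.
- rewrite -vn; have [iv|vi] := leqP i (size v); first exact: approx_pen.
  apply/approx_lspan/lspan_dict; right; rewrite pickle_pen; split.
    by rewrite normrE nrm_pen rmorph1.
  split=> [w|w j jw]; first exact: ip_pen_node.
  by rewrite ip_pen_pen; case: eqP => //= vw; case: eqP => // ij; rewrite vw ij ltnNge jw in vi.
apply/approx_lspan/lspan_dict; right; split.
  by rewrite normrE nrm_unit ?rmorph1 // on eqxx.
have out (t : seq nat * nat) : ip (b n) (b (pickle t)) = 0.
  by rewrite on; case: eqP => // nt; case: no; exists t.
by split=> *; apply: out.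
Qed.

(** The Fourier series of z along b is in the closure of the span of the
    dictionary, and the remainder is orthogonal to b, hence a multiple of a unit
    vector of the second part of the dictionary. *)
Lemma approx_all z : approx z.
Proof.
pose c n := ip z (b n).
have [|x xP] := orthonormal_series on (c := c) (B := nrm z ^+ 2).
  move=> n; rewrite -(big_mkord xpredT (fun i => absR (c i) ^+ 2)).
  by apply: bessel => [|i j _ _]; [exact: iota_uniq|exact: on].
have ax : approx x.
  apply: approx_lim => e e0; have [N NP] := xP e e0.
  exists (\sum_(i < N) c i *: b i); last exact: NP.
  by apply: approx_sum => i _; apply/approxZ/approx_b.
rewrite -(subrK x z); apply: approxD => //.
have zx j : ip (z - x) (b j) = 0 by rewrite ipBl (@ip_series b c on x xP) subrr.
have [->|w0] := eqVneq (z - x) 0.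
  by rewrite -[0](scale0r x); apply: approxZ.
have -> : z - x = `|z - x| *: (`|z - x|^-1 *: (z - x)).
  by rewrite scalerA mulfV ?scale1r // normr_eq0.
apply/approxZ/approx_lspan/lspan_dict; right; split.
  by case: (normalize w0).
by split=> *; rewrite ipZl zx mulr0.
Qed.

Lemma dict_universal : universal_dictionary re dict.
Proof.
split; last exact: dict_attains_deviations.
split=> [g [[v [l [_ ->]]]|[//]]|]; first by case: (normalize (atom_neq0 v l)).
rewrite eqEsubset; split=> // z _ B /nbhs_ballP[eps eps0 epsB].
have epsE : eps = io (re eps) by rewrite -(gtr0_norm eps0) -normE.
have e0 : 0 < re eps by rewrite -io_lt -epsE rmorph0.
have [y ly zy] := approx_all z e0; exists y; split=> //; apply: epsB.
by rewrite -ball_normE /ball_ /= epsE normrE io_lt.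
Qed.

End Dictionary.

Theorem universal_dictionary_exists : infinite_dimensional H ->
  exists D : set H, universal_dictionary re D.
Proof.
by case/orthonormal_sequence => b on; exists (dict b); apply: dict_universal.
Qed.

End HilbertSpace.

Theorem mainTheorem5 (R : realType) :
  (forall (H : completeNormedModType R) (ip : {dot H for idfun}),
     norm_of_dot ip -> infinite_dimensional H ->
     exists D : set H, universal_dictionary idfun D)
  /\
  (forall (H : completeNormedModType R[i]) (ip : {dot H for Num.conj}),
     norm_of_dot ip -> infinite_dimensional H ->
     exists D : set H, universal_dictionary (@complex.Re R) D).
Proof.
split=> H ip ipn infH.
  apply: (@universal_dictionary_exists R R idfun idfun idfun _ _ _ _ H ip) => //.
    by move=> a x y z; rewrite linearPl.
  by move=> x y; rewrite (hermitian_subproof (s := ip)) expr0 mul1r.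
apply: (@universal_dictionary_exists R R[i]%C (@complex.Re R) (real_complex R)
  Num.conj _ _ _ _ H ip) => //.
- exact: lecR.
- exact: conjC0.
- by move=> a x y z; rewrite linearPl.
by move=> x y; rewrite (hermitian_subproof (s := ip)) expr0 mul1r.
Qed.
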